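(* For every $f\in C[0,\pi]$, $$\lim_{n\to\infty}\|\mathcal{GK}_n(f)-f\|_\infty=0,$$ where $\|\cdot\|_\infty$ is the sup-norm over $[0,\pi]$ and $\mathcal{GK}_n$ is the $n$-th Grünwald–Kantorovich operator.
   Context: For $n\in\mathbb{N}$ and $k=1,\dots,n$ let $\theta_k^{(n)}=\frac{(2k-1)\pi}{2n}$ and, for real $\theta$, let $$P_k(\theta)=(-1)^{k+1}\frac{\cos(n\theta)\sin\theta_k^{(n)}}{n(\cos\theta-\cos\theta_k^{(n)})}$$ (the dependence on $n$ is suppressed; $P_k$ is extended by continuity at the removable singularities, so it is a polynomial in $\cos\theta$, namely the fundamental Lagrange polynomial at the Chebyshev nodes $\cos\theta_k^{(n)}$ evaluated at $\cos\theta$). The Grünwald–Kantorovich operators are defined for integrable $f$ on $[0,\pi]$ and $\theta\in[0,\pi]$ by $$\mathcal{GK}_n(f)(\theta)=\frac{n}{\pi}\sum_{k=1}^n\left(\int_{\theta_k^{(n)}}^{\theta_k^{(n)}+\frac{\pi}{2n}}f(t)\,dt\right)\left\{P_k\left(\theta+\frac{\pi}{2n}\right)+P_k\left(\theta-\frac{\pi}{2n}\right)\right\}.$$ *)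

(* Defs.v *)
From mathcomp Require Import all_boot all_order all_algebra.
From mathcomp Require Import all_classical all_reals all_analysis.

Set Implicit Arguments.
Unset Strict Implicit.
Unset Printing Implicit Defensive.

Import Order.TTheory GRing.Theory Num.Theory.
Import numFieldNormedType.Exports.

Local Open Scope classical_set_scope.
Local Open Scope ring_scope.

Definition cheb_angle (R : realType) (n k : nat) : R :=
  (2 * k%:R - 1) * pi / (2 * n%:R).

Definition lagrange_quot (R : realType) (n k : nat) (theta : R) : R :=
  (-1) ^+ k.+1 * (cos (n%:R * theta) * sin (cheb_angle R n k)) /
  (n%:R * (cos theta - cos (cheb_angle R n k))).

(* Where the denominator vanishes, the value is the limit of the quotient along
   the deleted neighbourhoods of theta (extension by continuity), rather than
   the value that the convention 0^-1 = 0 would give. *)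
Definition lagrange_cheb (R : realType) (n k : nat) (theta : R) : R :=
  if cos theta == cos (cheb_angle R n k)
  then lim (lagrange_quot n k t @[t --> theta^'])
  else lagrange_quot n k theta.

Definition grunwald_kantorovich (R : realType) (n : nat) (f : R -> R)
    (theta : R) : R :=
  n%:R / pi *
  \sum_(1 <= k < n.+1)
    (\int[lebesgue_measure]_(t in `[cheb_angle R n k,
                                    cheb_angle R n k + pi / (2 * n%:R)]) f t) *
    (lagrange_cheb n k (theta + pi / (2 * n%:R)) +
     lagrange_cheb n k (theta - pi / (2 * n%:R))).

(* The sup is taken in \bar R, so that an unbounded function gets +oo; the
   real-valued [sup] of an unbounded set is 0. *)
Definition supnorm0pi (R : realType) (g : R -> R) : \bar R :=
  ereal_sup [set (`|g theta|)%:E | theta in `[0, pi]].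

(* Main.v *)
Require Import Defs.
From mathcomp Require Import all_boot all_order all_algebra.
From mathcomp Require Import all_classical all_reals all_analysis.
From mathcomp Require Import ring lra.

Set Implicit Arguments.
Unset Strict Implicit.

Import Order.TTheory GRing.Theory Num.Theory.
Import numFieldNormedType.Exports.
Local Open Scope classical_set_scope.
Local Open Scope ring_scope.

(* With h = pi/2n, the pair P_k(theta+h) + P_k(theta-h) of Lagrange kernels sums
   to 2 over k and decays quadratically: since cos(n(theta+-h)) = -+sin(n theta),
   the leading parts of the two kernels cancel, leaving a bound
   20/(1+u^2) with u = n(theta_k - theta)/pi, whose sum over k is bounded.
   Combining this with |f x - f y| <= e + K(x-y)^2, which holds for every e > 0
   and some K by uniform continuity, gives |GK_n f - f| <= 80 e + 320 K/n. *)

(** * Trigonometric identities and elementary bounds for the sine *)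

Section Trigonometry.
Variable R : realType.
Implicit Types x y t phi : R.

Lemma cosSS (n : nat) phi :
  cos (n.+2%:R * phi) = 2 * cos phi * cos (n.+1%:R * phi) - cos (n%:R * phi).
Proof.
have -> : n.+2%:R * phi = n.+1%:R * phi + phi by rewrite -[n.+2]addn1 natrD; ring.
have -> : n%:R * phi = n.+1%:R * phi - phi by rewrite -[n.+1]addn1 natrD; ring.
by rewrite cosD cosB; ring.
Qed.

(** Induction on [n] through the three-term recurrence [cosSS]. When [t] is a Chebyshev node of
    order [n.+1], the second product on the right vanishes, which expands the Lagrange polynomial in
    cosines. *)
Lemma christoffel_darboux_cos (n : nat) phi t :
  (cos phi - cos t) *
    (1 + 2 * \sum_(1 <= j < n.+1) cos (j%:R * t) * cos (j%:R * phi)) =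
  cos (n.+1%:R * phi) * cos (n%:R * t) - cos (n.+1%:R * t) * cos (n%:R * phi).
Proof.
elim: n => [|n IH]; first by rewrite big_geq// !mul0r cos0 !mul1r; ring.
rewrite big_nat_recr//= (mulrDr 2) addrA (mulrDr (_ - _)) IH !cosSS; ring.
Qed.

(** The mean value theorem gives sin (x/2) >= (x/2) cos (x/2), hence sin x >= x cos^2 (x/2), and
    cos^2 (x/2) = (1 + cos x)/2 >= 1/2 on this range. *)
Lemma half_le_sin x : 0 <= x <= pi / 2 -> x / 2 <= sin x.
Proof.
move=> /andP[x0 xpi]; have pi0 := @pi_gt0 R.
have y0 : 0 <= x / 2 by lra.
have cont : {within `[0, x / 2], continuous (@sin R)}.
  exact/continuous_subspaceT/continuous_sin.
have [c] := MVT_segment y0 (fun z _ => is_derive_sin z) cont.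
rewrite in_itv/= sin0 !subr0 => /andP[c0 cx] sE.
have cosle : cos (x / 2) <= cos c.
  have [->//|ne] := eqVneq c (x / 2).
  have cx' : c < x / 2 by rewrite lt_neqAle ne.
  by apply/ltW; rewrite ltr_cos ?in_itv//=; apply/andP; split; lra.
have cpos : 0 <= cos (x / 2) by apply: cos_ge0_pihalf; apply/andP; split; lra.
have cx0 : 0 <= cos x by apply: cos_ge0_pihalf; apply/andP; split; lra.
have xx : x = (x / 2) *+ 2 by rewrite mulr2n; lra.
have : cos x = cos (x / 2) ^+ 2 *+ 2 - 1 by rewrite {1}xx cos_mulr2n.
have -> : sin x = (cos (x / 2) * sin (x / 2)) *+ 2 by rewrite {1}xx sin_mulr2n.
rewrite sE => cE.
have : 0 <= (cos c - cos (x/2)) * (cos (x / 2) * (x / 2)).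
  by apply: mulr_ge0; [lra|apply: mulr_ge0].
have : 0 <= (cos (x / 2) ^+ 2 - 2^-1) * x by apply: mulr_ge0 => //; lra.
by move=> ? ?; rewrite (mulr2n (_ * _)); lra.
Qed.

Lemma sin_le x : 0 <= x -> sin x <= x.
Proof.
move=> x0.
have cont : {within `[0, x], continuous (@sin R)}.
  exact/continuous_subspaceT/continuous_sin.
have [c _] := MVT_segment x0 (fun z _ => is_derive_sin z) cont.
rewrite sin0 !subr0 => ->; have := cos_le1 c; nra.
Qed.

Lemma one_sub_cos x : 1 - cos x = 2 * sin (x / 2) ^+ 2.
Proof.
have xx : x = (x / 2) *+ 2 by rewrite mulr2n; lra.
by rewrite {1}xx cos_mulr2n sin2cos2 mulr2n; ring.
Qed.

End Trigonometry.

(** * Chebyshev nodes and the fundamental Lagrange polynomials *)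

Section ChebyshevNodes.
Variable R : realType.
Implicit Types (n k j : nat) (theta phi t : R).

Lemma cheb_angle_bounds n k : (1 <= k <= n)%N ->
  0 < cheb_angle R n k /\ cheb_angle R n k + pi / (2 * n%:R) <= pi.
Proof.
move=> /andP[k1 kn]; have n0 : 0 < n%:R :> R by rewrite ltr0n (leq_trans k1).
have pi0 := @pi_gt0 R.
have k1' : 1 <= k%:R :> R by rewrite ler1n.
have kn' : k%:R <= n%:R :> R by rewrite ler_nat.
rewrite /cheb_angle; split; first by apply: divr_gt0; nra.
have -> : (2 * k%:R - 1) * pi / (2 * n%:R) + pi / (2 * n%:R) =
  (k%:R * pi) / n%:R :> R by field; lra.
rewrite ler_pdivrMr//; nra.
Qed.

Lemma cos_sin_cheb_angle n k : (0 < n)%N -> (0 < k)%N ->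
  cos (n%:R * cheb_angle R n k) = 0 /\
  sin (n%:R * cheb_angle R n k) = (-1) ^+ k.+1.
Proof.
move=> n0; have n0' : n%:R != 0 :> R by rewrite pnatr_eq0 -lt0n.
have -> : n%:R * cheb_angle R n k = (2 * k%:R - 1) * (pi / 2).
  by rewrite /cheb_angle; field.
case: k => // k _; elim: k => [|k [IHc IHs]].
  have -> : (2 * 1 - 1) * (pi / 2) = pi / 2 :> R by ring.
  by rewrite cos_pihalf sin_pihalf sqrrN expr1n.
have -> : (2 * k.+2%:R - 1) * (pi / 2) = (2 * k.+1%:R - 1) * (pi / 2) + pi :> R.
  by rewrite -[k.+2]addn1 natrD; lra.
by rewrite cosDpi sinDpi IHc IHs oppr0 !exprS; split => //; ring.
Qed.

(** Multiplied by sin h with h = j pi / 2n, the sum telescopes to sin (j pi) / 2 = 0; the range of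
    [j] keeps sin h nonzero. *)
Lemma sum_cos_cheb_angle n j : (0 < j < n)%N ->
  \sum_(1 <= k < n.+1) cos (j%:R * cheb_angle R n k) = 0.
Proof.
move=> /andP[j0 jn]; have n0 : 0 < n%:R :> R by rewrite ltr0n (leq_trans _ jn).
have j0' : 0 < j%:R :> R by rewrite ltr0n.
have jn' : j%:R < n%:R :> R by rewrite ltr_nat.
have pi0 := @pi_gt0 R.
pose h : R := j%:R * pi / (2 * n%:R).
have hE : h * (2 * n%:R) = j%:R * pi by rewrite /h; field; lra.
have sh : sin h != 0 by apply/lt0r_neq0/sin_gt0_pi/andP; split; nra.
apply/eqP; rewrite -(mulIr_eq0 _ (mulIf sh)) mulr_suml; apply/eqP.
(* The angle j theta_k = (2k - 1) h lies midway between 2 (k - 1) h and 2 k h, hence the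
   predecessor. *)
pose g k : R := sin (2 * k.-1%:R * h) / 2.
rewrite (eq_big_nat _ _ (F2 := fun k => g k.+1 - g k)); last first.
  case=> // k _; rewrite /g /=.
  have -> : j%:R * cheb_angle R n k.+1 = 2 * k%:R * h + h.
    by rewrite /cheb_angle /h -[k.+1]addn1 natrD; field; lra.
  have -> : 2 * k.+1%:R * h = 2 * k%:R * h + h + h.
    by rewrite -[k.+1]addn1 natrD; ring.
  set a := 2 * k%:R * h + h.
  have -> : 2 * k%:R * h = a - h by rewrite /a addrK.
  by rewrite sinD sinB; field.
rewrite telescope_sumr// /g /= mulr0 mul0r sin0 mul0r subr0.
have -> : 2 * n%:R * h = j%:R * pi by lra.
suff -> : sin (j%:R * pi) = 0 :> R by rewrite mul0r.
elim: (j) => [|i IH]; first by rewrite mul0r sin0.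
by rewrite -addn1 natrD mulrDl mul1r sinDpi IH oppr0.
Qed.

(* The polynomial form of P_k: it has no singularities and is trivially bounded
   by 2. *)
Definition cheb_kernel n k phi : R :=
  (1 + 2 * \sum_(1 <= j < n) cos (j%:R * cheb_angle R n k) * cos (j%:R * phi)) /
  n%:R.

(** Christoffel-Darboux in degree n - 1 at the node t, where cos (n t) = 0 and cos ((n - 1) t) = sin
    (n t) sin t = (-1)^(k+1) sin t. Without division, the identity also holds at the
    singularities. *)
Lemma cheb_kernelP n k phi : (0 < n)%N -> (0 < k)%N ->
  n%:R * (cos phi - cos (cheb_angle R n k)) * cheb_kernel n k phi =
  (-1) ^+ k.+1 * (cos (n%:R * phi) * sin (cheb_angle R n k)).
Proof.
move=> n0 k0; have [c0 s1] := cos_sin_cheb_angle n0 k0.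
case: n n0 c0 s1 => // n _ c0 s1.
set t := cheb_angle R n.+1 k in c0 s1 *.
have n0 : n.+1%:R != 0 :> R by rewrite pnatr_eq0.
rewrite /cheb_kernel -/t [X in X = _](_ : _ = (cos phi - cos t) *
    (1 + 2 * \sum_(1 <= j < n.+1) cos (j%:R * t) * cos (j%:R * phi))); last first.
  by field.
rewrite christoffel_darboux_cos c0 mul0r subr0.
have -> : n%:R * t = n.+1%:R * t - t by rewrite -[n.+1]addn1 natrD; ring.
by rewrite cosB c0 s1; ring.
Qed.

Lemma norm_cheb_kernel n k phi : `|cheb_kernel n k phi| <= 2.
Proof.
case: n => [|n]; first by rewrite /cheb_kernel invr0 mulr0 normr0.
rewrite /cheb_kernel normrM normfV (ger0_norm (ler0n _ _)).
rewrite ler_pdivrMr ?ltr0n//.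
rewrite (le_trans (ler_normD _ _))// normr1 normrM (@ger0_norm _ 2)//.
have : `|\sum_(1 <= j < n.+1) cos (j%:R * cheb_angle R n.+1 k) * cos (j%:R * phi)|
    <= n%:R.
  apply: (le_trans (ler_norm_sum _ _ _)).
  apply: (@le_trans _ _ (\sum_(1 <= j < n.+1) 1)).
    apply: ler_sum => j _; rewrite normrM mulr_ile1// cos_max//.
  by rewrite sumr_const_nat subn1.
have -> : n.+1%:R = n%:R + 1 :> R by rewrite -addn1 natrD.
lra.
Qed.

(** Lagrange interpolation reproduces the constant 1: after exchanging the sums, every frequency 0 <
    j < n sums to zero over the nodes. *)
Lemma sum_cheb_kernel n phi : (0 < n)%N ->
  \sum_(1 <= k < n.+1) cheb_kernel n k phi = 1.
Proof.
move=> n0; have n0' : n%:R != 0 :> R by rewrite pnatr_eq0 -lt0n.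
rewrite -mulr_suml big_split/= sumr_const_nat subn1 -mulr_sumr exchange_big_nat//=.
rewrite big_nat_cond big1 => [|j]; first by rewrite mulr0 addr0 divff.
by rewrite andbT => jn; rewrite -mulr_suml sum_cos_cheb_angle// mul0r.
Qed.

Lemma continuous_cheb_kernel n k : continuous (cheb_kernel n k).
Proof.
move=> phi; rewrite /cheb_kernel; apply: cvgM; last exact: cvg_cst.
apply: cvgD; first exact: cvg_cst.
apply: cvgM; first exact: cvg_cst.
apply: cvg_big => [|j _]; first exact: add_continuous.
apply: cvgM; first exact: cvg_cst.
apply: (@continuous_comp _ _ _ (fun x : R => j%:R * x) (@cos R)).
  exact: mulrl_continuous.
exact: continuous_cos.
Qed.

(** In cos t - cos phi = -2 sin ((t + phi)/2) sin ((t - phi)/2), the first sine stays nonzero near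
    [phi] by continuity, and the second is nonzero for 0 < |t - phi| < 2 pi. *)
Lemma near_cos_neq phi : sin phi != 0 -> \forall t \near phi^', cos t != cos phi.
Proof.
move=> s0; have s1 : `|sin phi| > 0 by rewrite normr_gt0.
have pi0 := @pi_gt0 R.
have : {for phi, continuous (fun t : R => sin ((t + phi) / 2))}.
  apply: (@continuous_comp _ _ _ (fun x : R => (x + phi) / 2) (@sin R)).
    by apply: cvgM; [apply: cvgD; [exact: cvg_id|]|]; exact: cvg_cst.
  exact: continuous_sin.
move=> /cvgr_neq0.
have -> : (phi + phi) / 2 = phi by lra.
move=> /(_ s0) ne; near=> t.
have : sin ((t + phi) / 2) != 0 by near: t; exact: nbhs_dnbhs.
have tphi : t != phi by near: t; exact: nbhs_dnbhs_neq.
have : `|t - phi| < 2 * pi.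
  near: t; apply: nbhs_dnbhs; near do rewrite distrC.
  by apply: nbhsx_ballx; lra.
set a := (t + phi) / 2; pose b := (t - phi) / 2.
have -> : t - phi = b * 2 by rewrite /b; lra.
have b0 : b != 0 by rewrite /b mulf_neq0// ?subr_eq0// invr_eq0.
move=> bpi sa; have sb : sin b != 0.
  have: 0 < sin `|b|.
    apply: sin_gt0_pi; rewrite normr_gt0 b0/=.
    by move: bpi; rewrite normrM (@ger0_norm _ 2)//; lra.
  have [|] := ger0P b => _; first by move=> /lt0r_neq0.
  by rewrite sinN oppr_gt0 => /ltr0_neq0.
have -> : t = a + b by rewrite /a /b; lra.
have -> : phi = a - b by rewrite /a /b; lra.
rewrite -subr_eq0 cosD cosB.
rewrite (_ : _ - _ = - 2 * (sin a * sin b)); last by ring.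
by rewrite !mulf_neq0// oppr_eq0.
Unshelve. all: by end_near. Qed.

(** Away from the singularities, divide in [cheb_kernelP]. At one of them sin^2 phi = sin^2 theta_k
    > 0, so the quotient agrees with the continuous kernel on a deleted neighbourhood and tends to
    its value. *)
Lemma lagrange_chebE n k phi : (1 <= k <= n)%N ->
  lagrange_cheb n k phi = cheb_kernel n k phi.
Proof.
move=> kn; have /andP[k0 kn'] := kn; have n0 := leq_trans k0 kn'.
have n0' : n%:R != 0 :> R by rewrite pnatr_eq0 -lt0n.
have quotE t : cos t != cos (cheb_angle R n k) ->
    lagrange_quot n k t = cheb_kernel n k t.
  move=> ne; rewrite /lagrange_quot -cheb_kernelP//; field.
  by rewrite n0' andbT subr_eq0.
rewrite /lagrange_cheb; case: ifPn => [/eqP cE|/quotE//].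
have [a0 api] := cheb_angle_bounds kn.
have sphi : sin phi != 0.
  have : sin phi ^+ 2 = sin (cheb_angle R n k) ^+ 2 by rewrite !sin2cos2 cE.
  rewrite -(sqrf_eq0 (sin phi)) => ->; rewrite sqrf_eq0.
  apply/lt0r_neq0/sin_gt0_pi/andP; split => //; apply: lt_le_trans api.
  by rewrite ltrDl divr_gt0 ?pi_gt0// mulr_gt0// ltr0n.
apply/cvg_lim => //; apply: (@cvg_trans _ (cheb_kernel n k t @[t --> phi^'])).
  apply: near_eq_cvg; near=> t; apply/esym/quotE; rewrite -cE.
  by near: t; exact: near_cos_neq.
by apply: cvg_within_filter; exact: continuous_cheb_kernel.
Unshelve. all: by end_near. Qed.

End ChebyshevNodes.

(** * Cancellation, decay and summability of the paired kernels *)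

Section KernelEstimates.
Variable R : realType.
Implicit Types (n k : nat) (theta u y : R).

Definition kernel_pair n k theta : R :=
  cheb_kernel n k (theta + pi / (2 * n%:R)) +
  cheb_kernel n k (theta - pi / (2 * n%:R)).

(** The signed distance from [theta] to the node in units of the spacing pi/n, so that consecutive
    [k] give unit steps. *)
Definition node_offset n k theta : R := k%:R - (n%:R * theta / pi + 2^-1).

Lemma cheb_angleB n k theta : (0 < n)%N ->
  cheb_angle R n k - theta = pi / n%:R * node_offset n k theta.
Proof.
move=> n0; have n0' : n%:R != 0 :> R by rewrite pnatr_eq0 -lt0n.
have pi0 : pi != 0 :> R by rewrite gt_eqF ?pi_gt0.
rewrite /cheb_angle /node_offset; move: pi pi0 => p p0.
by field; rewrite n0' p0.
Qed.

Lemma norm_kernel_pair n k theta : `|kernel_pair n k theta| <= 4.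
Proof.
apply: (le_trans (ler_normD _ _)).
have := @norm_cheb_kernel R n k (theta + pi / (2 * n%:R)).
have := @norm_cheb_kernel R n k (theta - pi / (2 * n%:R)).
lra.
Qed.

Lemma sum_kernel_pair n theta : (0 < n)%N ->
  \sum_(1 <= k < n.+1) kernel_pair n k theta = 2.
Proof. by move=> n0; rewrite big_split/= !sum_cheb_kernel. Qed.

(** Both sides are differences of squares that agree once sin^2 = 1 - cos^2. This rewrites the
    common denominator of the two shifted kernels with [h] and [t] exchanged. *)
Lemma mul_cosDB theta (t h : R) :
  (cos (theta + h) - cos t) * (cos (theta - h) - cos t) =
  (cos h - cos (theta + t)) * (cos h - cos (theta - t)).
Proof.
rewrite !cosD !cosN !sinN.
rewrite [LHS](_ : _ = (cos theta * cos h - cos t) ^+ 2 -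
  sin theta ^+ 2 * sin h ^+ 2); last by ring.
rewrite [RHS](_ : _ = (cos h - cos theta * cos t) ^+ 2 -
  sin theta ^+ 2 * sin t ^+ 2); last by ring.
rewrite !sin2cos2; ring.
Qed.

(* The two shifts turn [cos (n theta)] into [-+ sin (n theta)], so the leading
   parts of the two kernels cancel. *)
Lemma kernel_pairE n k theta (h := pi / (2 * n%:R)) (t := cheb_angle R n k) :
  (0 < n)%N -> (0 < k)%N ->
  n%:R * kernel_pair n k theta *
    ((cos h - cos (theta + t)) * (cos h - cos (theta - t))) =
  (-1) ^+ k * sin (n%:R * theta) * sin h * (cos (theta - t) - cos (theta + t)).
Proof.
move=> n0 k0; have n0' : n%:R != 0 :> R by rewrite pnatr_eq0 -lt0n.
have := cheb_kernelP (theta + h) n0 k0; have := cheb_kernelP (theta - h) n0 k0.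
have -> : n%:R * (theta + h) = n%:R * theta + pi / 2 by rewrite /h; field.
have -> : n%:R * (theta - h) = n%:R * theta - pi / 2 by rewrite /h; field.
rewrite cosDpihalf cosBpihalf -/t -mul_cosDB /kernel_pair -/h.
set K1 := cheb_kernel _ _ _; set K2 := cheb_kernel _ _ _ => E1 E2.
set D1 := cos (theta + h) - _ in E2 *; set D2 := cos (theta - h) - _ in E1 *.
rewrite [LHS](_ : _ = (n%:R * D1 * K2) * D2 + (n%:R * D2 * K1) * D1); last by ring.
rewrite E1 E2 /D1 /D2 !cosD !cosN !sinN exprS; ring.
Qed.

(** Near the node the trivial bound 4 suffices. Far from it, the denominator in [kernel_pairE] is
    comparable to X Y, where X absorbs the numerator and Y is at least of order (h u)^2. *)
Lemma kernel_pair_bound n k theta : (1 <= k <= n)%N -> 0 <= theta <= pi ->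
  `|kernel_pair n k theta| <= 20 / (1 + node_offset n k theta ^+ 2).
Proof.
move=> kn /andP[th0 thpi]; have /andP[k0 kn'] := kn.
have n0 := leq_trans k0 kn'; have n0' : 0 < n%:R :> R by rewrite ltr0n.
have pi2 := @pi_ge2 R.
have [a0 api] := @cheb_angle_bounds R _ _ kn.
have := kernel_pairE theta n0 k0; have := cheb_angleB k theta n0.
have := norm_kernel_pair n k theta.
set Q := kernel_pair _ _ _; set u := node_offset _ _ _.
rewrite ler_pdivlMr; last by have := sqr_ge0 u; lra.
set t := cheb_angle _ _ _ in a0 api *.
set h := pi / (2 * n%:R) in api *; have h0 : 0 < h by rewrite divr_gt0//; lra.
have nh : n%:R * h = pi / 2 by rewrite /h; field; lra.
move=> Q4 tE QE.
(* For u^2 <= 4 the trivial bound gives 4 (1 + u^2) <= 20, the source of the constant. *)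
have [u4|u4] := leP (u ^+ 2) 4.
  by have := normr_ge0 Q; nra.
have hu : (theta - t) / 2 = - (h * u).
  have -> : theta - t = - (pi / n%:R * u) by rewrite -tE; ring.
  by rewrite /h; field; lra.
pose X := 1 - cos (theta + t); pose Y := 1 - cos (theta - t); pose Z := 1 - cos h.
(* As both points lie in [0, pi], |h u| = |theta - t| / 2 <= pi / 2, so [half_le_sin] applies. *)
have Yge : h ^+ 2 * u ^+ 2 / 2 <= Y.
  rewrite /Y one_sub_cos hu sinN sqrrN.
  have -> : sin (h * u) ^+ 2 = sin `|h * u| ^+ 2.
    by have [//|_] := ger0P (h * u); rewrite sinN sqrrN.
  have -> : h ^+ 2 * u ^+ 2 / 2 = 2 * (`|h * u| / 2) ^+ 2.
    by rewrite (exprMn _ `|_|) real_normK ?num_real// (exprMn _ h); field.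
  rewrite ler_pM2l// lerXn2r ?nnegrE ?divr_ge0//.
  - apply: le_trans (half_le_sin _); rewrite ?divr_ge0//.
    by rewrite normr_ge0/= -normrN -hu ler_norml; apply/andP; split; lra.
  - apply: half_le_sin.
    by rewrite normr_ge0/= -normrN -hu ler_norml; apply/andP; split; lra.
have Zle : Z <= h ^+ 2 / 2.
  rewrite /Z one_sub_cos.
  have -> : h ^+ 2 / 2 = 2 * (h / 2) ^+ 2 by field.
  have s0 : 0 <= sin (h / 2).
    apply: sin_ge0_pi; have : 1 <= n%:R :> R by rewrite ler1n.
    by move=> n1; apply/andP; split; nra.
  by rewrite ler_pM2l// lerXn2r ?nnegrE//; [lra|apply: sin_le; lra].
have XY : Y <= X.
  rewrite -subr_ge0 (_ : X - Y = 2 * (sin theta * sin t)); last first.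
    by rewrite /X /Y cosD cosB; ring.
  rewrite !mulr_ge0 ?sin_ge0_pi//; apply/andP; split; lra.
have h20 : 0 < h ^+ 2 by rewrite exprn_gt0.
have Z0 : 0 <= Z by rewrite subr_ge0 cos_le1.
(* Here u^2 > 4 enters: Y >= 2 h^2 >= 4 Z. *)
have YZ : 4 * Z <= Y by nra.
have Y0 : 0 < Y by nra.
have QEn : n%:R * `|Q| * ((X - Z) * (Y - Z)) <= h * (X - Y).
  have -> : n%:R * `|Q| * ((X - Z) * (Y - Z)) = `|n%:R * Q *
      ((cos h - cos (theta + t)) * (cos h - cos (theta - t)))|.
    rewrite (_ : (cos h - _) * _ = (X - Z) * (Y - Z)); last by rewrite /X /Y /Z; ring.
    rewrite 2!normrM (ger0_norm (ltW n0')) (@ger0_norm _ ((X - Z) * _))//.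
    by rewrite mulr_ge0//; lra.
  rewrite QE -/h (_ : cos (theta - t) - _ = X - Y); last by rewrite /X /Y; ring.
  rewrite !normrM normrX normrN1 expr1n mul1r (@ger0_norm _ (X - Y)) ?subr_ge0//.
  rewrite ler_wpM2r ?subr_ge0//.
  have sh0 : 0 <= sin h.
    apply: sin_ge0_pi; have : 1 <= n%:R :> R by rewrite ler1n.
    by move=> n1; apply/andP; split; nra.
  rewrite (ger0_norm sh0) -[leRHS]mul1r ler_pM ?sin_max//.
  by apply: sin_le; lra.
(* From X >= Y >= 4 Z follow X - Z >= X / 2 and Y - Z >= Y / 2. *)
have XYZ : X * Y <= 4 * ((X - Z) * (Y - Z)).
  have : 0 <= (X - 2 * Z) * (Y - Z) by apply: mulr_ge0; lra.
  have : 0 <= X * (Y - 2 * Z) by apply: mulr_ge0; lra.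
  lra.
(* Bounding X - Y by X in [QEn] lets the positive factor X cancel. *)
have QX : X * (n%:R * `|Q| * Y) <= X * (4 * h).
  have nQ0 : 0 <= n%:R * `|Q| by rewrite mulr_ge0// ltW.
  have := ler_wpM2l nQ0 XYZ; have : 0 <= h * Y by apply: mulr_ge0; lra.
  lra.
rewrite ler_pM2l in QX; last lra.
have QX' : n%:R * `|Q| * (h ^+ 2 * u ^+ 2 / 2) <= 4 * h.
  by apply: le_trans QX; rewrite ler_wpM2l// mulr_ge0// ltW.
(* Since n h = pi / 2, the bound no longer depends on [n]; pi >= 2 then gives |Q| u^2 <= 8, and 4 +
   8 <= 20. *)
have : h * (`|Q| * u ^+ 2 * pi) <= h * 16.
  have -> : h * (`|Q| * u ^+ 2 * pi) = 4 * (n%:R * `|Q| * (h ^+ 2 * u ^+ 2 / 2)).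
    rewrite [RHS](_ : _ = h * (`|Q| * u ^+ 2 * (2 * (n%:R * h)))); last by field.
    by rewrite nh (mulrC 2) divfK.
  lra.
rewrite ler_pM2l// => QX2.
have Qu0 : 0 <= `|Q| * u ^+ 2 by rewrite mulr_ge0 ?sqr_ge0.
have : `|Q| * u ^+ 2 <= 8 by nra.
have := normr_ge0 Q; nra.
Qed.

(* u / (1 + |u|) is bounded, so this telescopes when summed over unit steps. *)
Lemma inv_one_add_sqr_le u :
  (1 + u ^+ 2)^-1 <= 4 * ((u + 1) / (1 + `|u + 1|) - u / (1 + `|u|)).
Proof.
have u2 := sqr_ge0 u; rewrite -[leLHS]mul1r ler_pdivrMr; last lra.
have [u0|u0] := ger0P u.
  rewrite ger0_norm; last lra.
  rewrite [leRHS](_ : _ = 4 * (1 + u ^+ 2) / ((1 + (u + 1)) * (1 + u))); last first.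
    by field; apply/andP; split; lra.
  by rewrite ler_pdivlMr ?mulr_gt0; nra.
have [u1|u1] := ger0P (u + 1).
  (* For -1 <= u < 0 the new factor is 1 + 2 (-u) (1 + u) >= 1. *)
  rewrite [leRHS](_ : _ = 4 * (1 - 2 * u - 2 * u ^+ 2) * (1 + u ^+ 2) /
     ((1 + (u + 1)) * (1 - u))); last first.
    by field; apply/andP; split; lra.
  by rewrite ler_pdivlMr ?mulr_gt0; nra.
rewrite [leRHS](_ : _ = 4 * (1 + u ^+ 2) / ((1 - (u + 1)) * (1 - u))); last first.
  by field; apply/andP; split; lra.
by rewrite ler_pdivlMr ?mulr_gt0; nra.
Qed.

(** The telescoped bound is a difference of two values of [g], each at most 4 in absolute value,
    whatever [n] and [y] are. *)
Lemma sum_inv_one_add_sqr n y :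
  \sum_(1 <= k < n.+1) (1 + (k%:R - y) ^+ 2)^-1 <= 8.
Proof.
pose g k : R := 4 * ((k%:R - y) / (1 + `|k%:R - y|)).
have g4 k : `|g k| <= 4.
  rewrite /g; set u := _ - y; have u0 := normr_ge0 u.
  have u1 : 0 < 1 + `|u| by lra.
  rewrite !normrM normfV (gtr0_norm u1) ger0_norm//.
  by rewrite -[leRHS]mulr1 ler_pM2l// ler_pdivrMr//; lra.
apply: (@le_trans _ _ (\sum_(1 <= k < n.+1) (g k.+1 - g k))).
  apply: ler_sum => k _; rewrite /g -mulrBr.
  have -> : k.+1%:R - y = k%:R - y + 1 by rewrite -addn1 natrD; ring.
  exact: inv_one_add_sqr_le.
rewrite telescope_sumr//; have := g4 n.+1; have := g4 1%N.
by rewrite !ler_norml => /andP[? ?] /andP[? ?]; lra.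
Qed.

End KernelEstimates.

(** * Quadratic modulus of continuity and integrals close to a constant *)

Section ModulusAndIntegral.
Variable R : realType.
Local Notation mu := (@lebesgue_measure R).

(** Heine-Cantor, with compactness in near-covering form: a property that holds locally for all
    small d > 0 holds on the whole segment for one such d. *)
Lemma segment_unif_continuous (f : R -> R) (a b e : R) :
  {within `[a, b], continuous f} -> 0 < e ->
  exists2 d : R, 0 < d & {in `[a, b] &, forall x y,
    `|x - y| < d -> `|f x - f y| <= e}.
Proof.
move=> /subspace_continuousP cf e0.
have cov : \forall d \near (0 : R)^'+, [set` `[a, b]] `<=`
    [set x | x \in `[a, b] -> {in `[a, b], forall y, `|x - y| < d ->
      `|f x - f y| <= e}].
  apply: (iffLR (compact_near_coveringP _) (@segment_compact R a b)) => x xab.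
  have /cvgrPdist_lt/(_ (e / 2)) := cf x xab.
  rewrite divr_gt0// => /(_ isT); rewrite near_withinE => /nbhs_ballP[r /= r0 fr].
  (* Two halves of [r] keep both z and every y with |z - y| < d inside the ball of radius [r] about
     [x]. *)
  exists (ball x (r / 2), [set d | d < r / 2]) => /=.
    split; first by apply: nbhsx_ballx; rewrite divr_gt0.
    by apply: nbhs_right_lt; rewrite divr_gt0.
  move=> [z d] /= [xz dr] zab y yab zyd.
  have : `|f x - f z| < e / 2.
    by apply: fr => //; apply: lt_trans xz _; lra.
  have : `|f x - f y| < e / 2.
    apply: fr => //; rewrite /ball/= -(subrKA z).
    apply: le_lt_trans (ler_normD _ _) _.
    by move: xz; rewrite /ball/=; lra.
  rewrite !ltr_norml ler_norml => /andP[? ?] /andP[? ?].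
  by apply/andP; split; lra.
near (0 : R)^'+ => d.
exists d; first by near: d; exact: nbhs_right_gt.
by move=> x y xab; apply: (near cov d).
Unshelve. all: by end_near. Qed.

(** Below the uniform continuity threshold d the term [e] suffices; beyond it (x - y)^2 / d^2 >= 1,
    so K = M / d^2 covers the total oscillation M. *)
Lemma continuous_quadratic_modulus (f : R -> R) (a b e : R) :
  a <= b -> {within `[a, b], continuous f} -> 0 < e ->
  exists2 K : R, 0 <= K & {in `[a, b] &, forall x y,
    `|f x - f y| <= e + K * (x - y) ^+ 2}.
Proof.
move=> ab cf e0.
have [c _ cmax] := EVT_max ab cf; have [c' _ cmin] := EVT_min ab cf.
have [d d0 fd] := segment_unif_continuous cf e0.
pose M := f c - f c'.
have fM : {in `[a, b] &, forall x y, `|f x - f y| <= M}.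
  move=> x y xab yab; have := cmax _ xab; have := cmin _ xab.
  have := cmax _ yab; have := cmin _ yab.
  by move=> *; rewrite ler_norml /M; apply/andP; split; lra.
have M0 : 0 <= M by apply: le_trans (fM a a _ _); rewrite ?in_itv/= ?lexx.
exists (M / d ^+ 2) => [|x y xab yab]; first by rewrite divr_ge0// sqr_ge0.
have K0 : 0 <= M / d ^+ 2 * (x - y) ^+ 2 by rewrite mulr_ge0 ?divr_ge0 ?sqr_ge0.
have [xyd|dxy] := ltP `|x - y| d; first by have := fd _ _ xab yab xyd; lra.
have : M <= M / d ^+ 2 * (x - y) ^+ 2.
  rewrite mulrAC ler_pdivlMr ?exprn_gt0// ler_wpM2l//.
  by rewrite -(@real_normK _ (x - y)) ?num_real// lerXn2r ?nnegrE// ltW.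
by have := fM _ _ xab yab; lra.
Qed.

Lemma Rintegral_sub_cst_le (f : R -> R) (a b c e : R) :
  a <= b -> {within `[a, b], continuous f} ->
  {in `[a, b], forall x, `|f x - c| <= e} ->
  `|\int[mu]_(x in `[a, b]) f x - (b - a) * c| <= (b - a) * e.
Proof.
move=> ab cf fe.
have If : mu.-integrable `[a, b] (EFin \o f).
  by apply: continuous_compact_integrable => //; exact: segment_compact.
have Ic r : mu.-integrable `[a, b] (EFin \o (fun=> r : R)).
  apply: continuous_compact_integrable; first exact: segment_compact.
  by apply: continuous_subspaceT => x; exact: cvg_cst.
have muE : fine (mu `[a, b]%classic) = b - a.
  by rewrite lebesgue_measure_itv/= lte_fin; case: ltP => //= ba; lra.
have cE r : \int[mu]_(x in `[a, b]) r = (b - a) * r.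
  by rewrite Rintegral_cst//= muE mulrC.
have lef x : `[a, b]%classic x -> c - e <= f x /\ f x <= c + e.
  move=> xab; have /fe : x \in `[a, b] by [].
  by rewrite ler_norml => /andP[? ?]; split; lra.
have : \int[mu]_(x in `[a, b]) f x <= \int[mu]_(x in `[a, b]) (c + e).
  by apply: le_Rintegral => // x /lef[].
have : \int[mu]_(x in `[a, b]) (c - e) <= \int[mu]_(x in `[a, b]) f x.
  by apply: le_Rintegral => // x /lef[].
move: (\int[mu]_(x in _) f x) => I.
by rewrite !cE ler_norml => ? ?; apply/andP; split; lra.
Qed.

End ModulusAndIntegral.

(** * Quantitative error estimate and passage to the limit *)

Section Error.
Variable R : realType.

(** The kernel decay 1/(1 + u^2) cancels the quadratic growth of the modulus. What remains is [e]
    times a bounded sum and [n] terms of order K h^2. *)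
Lemma grunwald_kantorovich_error (f : R -> R) (e K : R) (n : nat) (theta : R) :
  (0 < n)%N -> 0 <= e -> 0 <= K ->
  {within `[0, pi], continuous f} ->
  {in `[0, pi] &, forall x y, `|f x - f y| <= e + K * (x - y) ^+ 2} ->
  theta \in `[0, pi] ->
  `|grunwald_kantorovich n f theta - f theta| <= 80 * e + 320 * K / n%:R.
Proof.
move=> n0 e0 K0 cf fK thpi; have n0' : 0 < n%:R :> R by rewrite ltr0n.
have pi0 := @pi_gt0 R; pose h : R := pi / (2 * n%:R).
have h0 : 0 < h by rewrite divr_gt0// mulr_gt0.
have nh : n%:R / pi * h = 2^-1.
  by rewrite /h; move: pi pi0 => p p0; field; apply/andP; split; lra.
pose Q k := kernel_pair n k theta.
pose u k := node_offset n k theta.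
pose a k := cheb_angle R n k.
pose c k := \int[lebesgue_measure]_(t in `[a k, a k + h]) f t.
(* The total weight is (n / pi) h 2 = 1, so [f theta] can be moved inside the sum. *)
have -> : grunwald_kantorovich n f theta - f theta =
    n%:R / pi * \sum_(1 <= k < n.+1) (c k - h * f theta) * Q k.
  have fE : f theta = n%:R / pi * \sum_(1 <= k < n.+1) h * f theta * Q k.
    by rewrite -mulr_sumr sum_kernel_pair// 2!mulrA nh; field.
  rewrite [X in _ - X = _]fE.
  rewrite -mulrBr -sumrB; congr (_ * _); apply: eq_big_nat => k kn.
  by rewrite !lagrange_chebE// mulrBl.
have term k : (1 <= k < n.+1)%N -> `|(c k - h * f theta) * Q k| <=
    h * (20 * e * (1 + u k ^+ 2)^-1 + 160 * K * h ^+ 2).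
  move=> kn; have [a0 api] := @cheb_angle_bounds R n k kn.
  have u1 : 0 < 1 + u k ^+ 2 by rewrite ltr_wpDr ?sqr_ge0.
  have sub : {subset `[a k, a k + h] <= `[0, pi]}.
    move=> t; rewrite !in_itv/= => /andP[? ?].
    by apply/andP; split; [apply: le_trans (ltW a0) _|apply: le_trans api].
  have ce : `|c k - (a k + h - a k) * f theta| <=
      (a k + h - a k) * (e + K * (8 * h ^+ 2 * (1 + u k ^+ 2))).
    apply: Rintegral_sub_cst_le; first by rewrite lerDl ltW.
      by apply: continuous_subspaceW cf => t; exact: sub.
    move=> t tk; apply: le_trans (fK _ _ (sub _ tk) thpi) _.
    rewrite lerD2l ler_wpM2l//.
    have aE : a k - theta = 2 * h * u k.
      by rewrite cheb_angleB// -/(u k) /h; field; lra.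
    move: tk; rewrite in_itv/= => /andP[tk tk'].
    (* By (p + q)^2 <= 2 p^2 + 2 q^2 with p = t - a_k in [0, h] and q = 2 h u, (t - theta)^2 <= 2
       h^2 + 8 h^2 u^2. *)
    have : 0 <= (t - a k - 2 * h * u k) ^+ 2 by exact: sqr_ge0.
    have : 0 <= (h - (t - a k)) * (h + (t - a k)) by apply: mulr_ge0; lra.
    have : 0 <= h ^+ 2 by exact: sqr_ge0.
    have -> : t - theta = (t - a k) + 2 * h * u k by lra.
    lra.
  have {}ce : `|c k - h * f theta| <= h * (e + K * (8 * h ^+ 2 * (1 + u k ^+ 2))).
    by move: ce; rewrite (addrAC _ h) subrr add0r.
  rewrite normrM; apply: (@le_trans _ _ (h * (e + K * (8 * h ^+ 2 * (1 + u k ^+ 2)))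
      * (20 / (1 + u k ^+ 2)))).
    by apply: ler_pM => //; apply: kernel_pair_bound => //; rewrite in_itv in thpi.
  (* The two sides are equal: 1 + u^2 cancels in the K term, and 8 * 20 = 160. *)
  move: (h) (1 + u k ^+ 2) u1 => h' v v0.
  by rewrite le_eqVlt; apply/orP; left; apply/eqP; field; rewrite gt_eqF.
have npi : 0 <= n%:R / pi :> R by rewrite divr_ge0// ltW.
rewrite normrM (ger0_norm npi).
apply: (@le_trans _ _ (n%:R / pi * \sum_(1 <= k < n.+1)
    h * (20 * e * (1 + u k ^+ 2)^-1 + 160 * K * h ^+ 2))).
  rewrite ler_wpM2l//.
  apply: le_trans (ler_norm_sum _ _ _) _.
  by apply: ler_sum_nat => k kn; exact: term.
(* The prefactor (n / pi) h = 1/2 halves 20 * 8 e and 640 K / n, the latter coming from pi / 2 <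
   2. *)
rewrite -mulr_sumr mulrA nh big_split/= -mulr_sumr sumr_const_nat subn1/=.
have := sum_inv_one_add_sqr n (n%:R * theta / pi + 2^-1).
rewrite -/(u _) => S8.
have : 20 * e * \sum_(1 <= k < n.+1) (1 + u k ^+ 2)^-1 <= 20 * e * 8.
  by rewrite ler_wpM2l//; lra.
have : (160 * K * h ^+ 2) *+ n <= 640 * K / n%:R.
  have -> : (160 * K * h ^+ 2) *+ n = 160 * K * (pi / 2) ^+ 2 / n%:R.
    by rewrite -mulr_natr /h; field; lra.
  rewrite ler_pM2r ?invr_gt0//.
  have -> : 640 * K = 160 * K * 2 ^+ 2 by ring.
  rewrite ler_wpM2l ?mulr_ge0// lerXn2r ?nnegrE//; first by lra.
  by apply/ltW/pihalf_lt2.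
have -> : 640 * K / n%:R = 2 * (320 * K / n%:R) by ring.
lra.
Qed.

(** The bound for e = 1 makes [S n] eventually finite, which reduces convergence to real numbers. *)
Lemma cvge0_near_le (S : nat -> \bar R) : (forall n, 0 <= S n)%E ->
  (forall e : R, 0 < e -> \forall n \near \oo, (S n <= e%:E)%E) ->
  S n @[n --> \oo] --> 0%E.
Proof.
move=> S0 Se; apply/fine_cvgP; split.
  have := Se 1 ltr01; apply: filterS => n Sn.
  by rewrite ge0_fin_numE//; apply: le_lt_trans Sn _; exact: ltry.
apply/cvgrPdist_le => e e0; have := Se e e0; apply: filterS => n Sn /=.
rewrite sub0r normrN ger0_norm ?fine_ge0// -lee_fin fineK//.
by rewrite ge0_fin_numE//; apply: le_lt_trans Sn _; exact: ltry.
Qed.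

Lemma supnorm0pi_ge0 (g : R -> R) : (0 <= supnorm0pi g)%E.
Proof.
apply: (@le_trans _ _ (`|g 0|)%:E); first by rewrite lee_fin.
apply: ereal_sup_ubound; exists 0 => //=.
by rewrite in_itv/= lexx pi_ge0.
Qed.

End Error.

Theorem theorem2p4 (R : realType) (f : R -> R)
    (hf : {within `[0, pi], continuous f}) :
  supnorm0pi (fun theta => grunwald_kantorovich n f theta - f theta)
    @[n --> \oo] --> 0%E.
Proof.
apply: cvge0_near_le => [n|e e0]; first exact: supnorm0pi_ge0.
(* With e / 160 the first error term is e / 2; the other half is reached once n >= 640 K / e. *)
have [|K K0 fK] := continuous_quadratic_modulus (@pi_ge0 R) hf (_ : 0 < e / 160).
  by rewrite divr_gt0.
near=> n.
have n0 : (0 < n)%N by near: n; exact: nbhs_infty_gt.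
have n0' : 0 < n%:R :> R by rewrite ltr0n.
apply: ge_ereal_sup => _ [theta thpi <-]; rewrite lee_fin.
have e160 : 0 <= e / 160 by rewrite divr_ge0// ltW.
apply: le_trans (grunwald_kantorovich_error n0 e160 K0 hf fK thpi) _.
suff : 320 * K / n%:R <= e / 2 by lra.
rewrite ler_pdivrMr// (mulrC (e / 2)) -ler_pdivrMr ?divr_gt0//.
by near: n; exact: nbhs_infty_ger.
Unshelve. all: by end_near. Qed.
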